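(* Let $k$ be a field and let $T$ be an algebraic torus over $k$. Then $T$ is retract rational if and only if $T$ is $p$-retract rational for every prime number $p$.
   Context: A $k$-variety $X$ (integral) is called retract rational if the identity map of $X$ factors rationally through some affine space, i.e. there exist $n$ and rational maps $X\dashrightarrow \mathbb{A}^n_k\dashrightarrow X$ over $k$ whose composition is defined and equals the identity of $X$ as a rational map. For a prime $p$, $X$ is called $p$-retract rational if there exist an integer $n$, a $k$-variety $X'$, a finite dominant morphism $f:X'\to X$ of degree not divisible by $p$, a morphism $s:X'\to\mathbb{A}^n_k$ and a rational map $\pi:\mathbb{A}^n_k\dashrightarrow X$ such that the composition $\pi\circ s$ is defined (the image of $s$ meets the domain of definition of $\pi$) and equals $f$ as a rational map. *)

(* Defs.v *)
From HB Require Import structures.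
From mathcomp Require Import all_boot all_order all_algebra.
From mathcomp Require Import mpoly.

Set Implicit Arguments.
Unset Strict Implicit.
Unset Printing Implicit Defensive.

Import GRing.Theory.

Local Open Scope ring_scope.
Local Open Scope quotient_scope.

(* A k-algebra is encoded as a commutative ring with a structure morphism from
   k.  Tori are affine, and a variety finite over an affine one is affine, so
   only affine varieties occur: an integral affine k-variety X is given by its
   coordinate ring k[X], a finitely generated k-algebra which is a domain. *)

Definition finite_type (k A : comNzRingType) (c : {rmorphism k -> A}) : Prop :=
  exists (n : nat) (x : 'I_n -> A),
    forall a : A, exists P : {mpoly k[n]}, a = mmap c x P.

Record affVariety (k : fieldType) := AffVariety {
  coord : idomainType;
  cst : {rmorphism k -> coord};
  coord_finite_type : finite_type cst
}.

Notation "x %:F" := (tofrac x) : ring_scope.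
Notation funfield X := {fraction (coord X)}.

Fact mpoly_finite_type (k : fieldType) (n : nat) :
  finite_type (@mpolyC n k : {rmorphism k -> {mpoly k[n]}}).
Proof.
exists n, (fun i => 'X_i) => P; exists P.
rewrite /mmap {1}(mpolyE P); apply: eq_bigr => m _.
by rewrite mul_mpolyC mmap1_id.
Qed.

Definition affspace (k : fieldType) (n : nat) : affVariety k :=
  AffVariety (@mpoly_finite_type k n).

(* Morphisms X -> Y are k-algebra morphisms k[Y] -> k[X]. *)
Record morphism (k : fieldType) (X Y : affVariety k) := Morphism {
  comorph : {rmorphism coord Y -> coord X};
  comorph_cst : forall c : k, comorph (cst Y c) = cst X c
}.

(* For d != 0: z lies in the subring k[X][1/d] = O(D(d)) of k(X), where D(d) is
   the principal open subset of X on which d does not vanish. *)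
Definition regular_fun (k : fieldType) (X : affVariety k) (d : coord X)
    (z : funfield X) : Prop :=
  exists (a : coord X) (m : nat), z = a%:F / d%:F ^+ m.

(* A rational map X --> Y is represented by a morphism D(d) -> Y with d != 0,
   i.e. by a k-algebra morphism k[Y] -> k[X][1/d]; two of them agree on a
   nonempty open subset iff they are equal as morphisms k[Y] -> k(X). *)
Record ratmap (k : fieldType) (X Y : affVariety k) := RatMap {
  rcomorph : {rmorphism coord Y -> funfield X};
  rcomorph_cst : forall c : k, rcomorph (cst Y c) = (cst X c)%:F;
  rcomorph_regular : exists2 d : coord X, d != 0 &
    forall b : coord Y, regular_fun d (rcomorph b)
}.

Section RatMapOfMorphism.
Variables (k : fieldType) (X Y : affVariety k) (f : morphism X Y).

Definition rcomorph_of : {rmorphism coord Y -> funfield X} :=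
  (@tofrac (coord X) \o comorph f)%FUN.

Fact rcomorph_of_cst (c : k) : rcomorph_of (cst Y c) = (cst X c)%:F.
Proof. by rewrite /= comorph_cst. Qed.

Fact rcomorph_of_regular : exists2 d : coord X, d != 0 &
  forall b : coord Y, regular_fun d (rcomorph_of b).
Proof.
exists 1; first exact: oner_neq0.
by move=> b; exists (comorph f b), 0%N; rewrite expr0 divr1.
Qed.

Definition ratmap_of : ratmap X Y := RatMap rcomorph_of_cst rcomorph_of_regular.
End RatMapOfMorphism.

Definition id_morphism (k : fieldType) (X : affVariety k) : morphism X X :=
  @Morphism k X X idfun (fun c => erefl).

(* The composition v o u is defined and equals w.  "Defined" means that the
   image of u meets the domain of definition of v: some principal open D(d) of
   Y on which v is a morphism meets the image of u, i.e. u^*(d) != 0 in k(X).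
   The composite sends c with v^*(c) = b / d^m to u^*(b) / u^*(d)^m. *)
Definition comp_is (k : fieldType) (X Y Z : affVariety k)
    (u : ratmap X Y) (v : ratmap Y Z) (w : ratmap X Z) : Prop :=
  exists2 d : coord Y, rcomorph u d != 0 &
    forall c : coord Z, exists (b : coord Y) (m : nat),
      rcomorph v c = b%:F / d%:F ^+ m /\
      rcomorph w c = rcomorph u b / rcomorph u d ^+ m.

Definition retract_rational (k : fieldType) (X : affVariety k) : Prop :=
  exists (n : nat) (u : ratmap X (affspace k n)) (v : ratmap (affspace k n) X),
    comp_is u v (ratmap_of (id_morphism X)).

(* The preimage D(f^*(a)) of every nonempty principal open D(a) is nonempty. *)
Definition dominant (k : fieldType) (X' X : affVariety k) (f : morphism X' X) :
    Prop :=
  forall a : coord X, a != 0 -> comorph f a != 0.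

Definition finite_morphism (k : fieldType) (X' X : affVariety k)
    (f : morphism X' X) : Prop :=
  exists (m : nat) (e : 'I_m -> coord X'), forall y : coord X',
    exists a : 'I_m -> coord X, y = \sum_(i < m) comorph f (a i) * e i.

(* The field embedding k(X) -> k(X') induced by a dominant f : X' -> X. *)
Definition funfield_map (k : fieldType) (X' X : affVariety k)
    (f : morphism X' X) (z : funfield X) : funfield X' :=
  (comorph f \n_(repr z))%:F / (comorph f \d_(repr z))%:F.

Fact funfield_mapE (k : fieldType) (X' X : affVariety k) (f : morphism X' X)
    (a b : coord X) : dominant f -> b != 0 ->
  funfield_map f (a%:F / b%:F) = (comorph f a)%:F / (comorph f b)%:F.
Proof.
move=> domf b0; rewrite /funfield_map; set z := a%:F / b%:F.
have d0 : \d_(repr z) != 0 by apply: denom_ratioP.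
have hz : z * (\d_(repr z))%:F = (\n_(repr z))%:F.
  rewrite -[X in X * _ = _](reprK z); unlock tofrac; rewrite -[LHS]pi_mul.
  apply/eqmodP/eqP; rewrite /FracField.mulf !numden_Ratio ?mulf_neq0 ?oner_eq0 //.
  by rewrite !mulr1 mulrC.
have fneq0 c : c != 0 -> (comorph f c)%:F != 0.
  by move=> /domf; rewrite tofrac_eq0.
apply/eqP; rewrite eqr_div ?fneq0 // -!tofracM -!rmorphM tofrac_eq.
apply/eqP; congr (comorph f _); apply/eqP.
rewrite -tofrac_eq !tofracM -hz /z.
by rewrite mulrAC divfK ?tofrac_eq0.
Qed.

(* [k(X') : k(X)] = d. *)
Definition has_degree (k : fieldType) (X' X : affVariety k) (f : morphism X' X)
    (d : nat) : Prop :=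
  exists e : 'I_d -> funfield X', forall y : funfield X',
    exists! a : {ffun 'I_d -> funfield X},
      y = \sum_(i < d) funfield_map f (a i) * e i.

Definition p_retract_rational (p : nat) (k : fieldType) (X : affVariety k) :
    Prop :=
  exists (n : nat) (X' : affVariety k) (f : morphism X' X),
    [/\ finite_morphism f, dominant f,
        exists2 d : nat, has_degree f d & ~~ (p %| d)%N &
        exists (s : morphism X' (affspace k n)) (v : ratmap (affspace k n) X),
          comp_is (ratmap_of s) v (ratmap_of f)].

(* X(R), for a k-algebra R with structure morphism r. *)
Record point (k : fieldType) (X : affVariety k) (R : comNzRingType)
    (r : {rmorphism k -> R}) := Point {
  pt : {rmorphism coord X -> R};
  pt_cst : forall c : k, pt (cst X c) = r c
}.

(* b is the image of a under X(h) : X(R) -> X(S); that h is a morphism of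
   k-algebras is then only needed on the image of k, where it follows. *)
Definition push_to (k : fieldType) (X : affVariety k) (R S : comNzRingType)
    (r : {rmorphism k -> R}) (s : {rmorphism k -> S}) (h : {rmorphism R -> S})
    (a : point X r) (b : point X s) : Prop :=
  forall x : coord X, pt b x = h (pt a x).

(* Group schemes over k, through their functor of points (Yoneda). *)
Record groupVariety (k : fieldType) := GroupVariety {
  gvar : affVariety k;
  gmul : forall (R : comNzRingType) (r : {rmorphism k -> R}),
    point gvar r -> point gvar r -> point gvar r;
  gone : forall (R : comNzRingType) (r : {rmorphism k -> R}), point gvar r;
  ginv : forall (R : comNzRingType) (r : {rmorphism k -> R}),
    point gvar r -> point gvar r;
  gmulA : forall (R : comNzRingType) (r : {rmorphism k -> R}),
    associative (@gmul R r);
  gmul1 : forall (R : comNzRingType) (r : {rmorphism k -> R}),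
    left_id (@gone R r) (@gmul R r);
  gmulV : forall (R : comNzRingType) (r : {rmorphism k -> R}),
    left_inverse (@gone R r) (@ginv R r) (@gmul R r);
  gmul_natural : forall (R S : comNzRingType) (r : {rmorphism k -> R})
      (s : {rmorphism k -> S}) (h : {rmorphism R -> S})
      (a b : point gvar r) (a' b' : point gvar s),
    push_to h a a' -> push_to h b b' -> push_to h (gmul a b) (gmul a' b')
}.

(* G_m^n(R) *)
Definition Gm_point (R : comNzRingType) (n : nat) (u : {ffun 'I_n -> R}) : Prop :=
  forall i : 'I_n, exists y : R, u i * y = 1.

(* An isomorphism G_K ~ G_m^n of group schemes over an extension K of k, as an
   isomorphism of group functors on K-algebras; G_K(R) is G(R), with R seen as
   a k-algebra through K. *)
Definition split_over (k : fieldType) (G : groupVariety k) (n : nat)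
    (K : fieldType) (iota : {rmorphism k -> K}) : Prop :=
  exists theta : forall (R : comNzRingType) (r : {rmorphism K -> R}),
      point (gvar G) (r \o iota)%FUN -> {ffun 'I_n -> R},
  [/\ forall (R : comNzRingType) (r : {rmorphism K -> R}),
        injective (theta R r),
      forall (R : comNzRingType) (r : {rmorphism K -> R}) (u : {ffun 'I_n -> R}),
        Gm_point u <-> exists a, theta R r a = u,
      forall (R : comNzRingType) (r : {rmorphism K -> R})
          (a b : point (gvar G) (r \o iota)%FUN),
        theta R r (gmul a b) = [ffun i => theta R r a i * theta R r b i] &
      forall (R S : comNzRingType) (r : {rmorphism K -> R})
          (s : {rmorphism K -> S}) (h : {rmorphism R -> S})
          (a : point (gvar G) (r \o iota)%FUN)
          (a' : point (gvar G) (s \o iota)%FUN),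
        (forall c : K, h (r c) = s c) -> push_to h a a' ->
        theta S s a' = [ffun i => h (theta R r a i)] ].

Definition algebraic_torus (k : fieldType) (T : groupVariety k) : Prop :=
  exists (n : nat) (K : closedFieldType) (iota : {rmorphism k -> K}),
    (forall x : K, algebraicOver iota x) /\ split_over T n iota.

(* Main.v *)
(* Call a point x of T over an extension L of k liftable if it is the value at
   some u in L^n of a point V of T over a localization k[y_1..y_n][1/g] with
   g(u) != 0.  T is retract rational iff its generic point eta is liftable.
   The liftable points form a subgroup of T(L).  The key fact is that if x in
   T(K) becomes liftable over a simple extension K(t) of degree d, then x^d is
   liftable over K: writing u = l(t) with l a tuple of polynomials of degree < d
   over K, the product of the V(l(r_i)), for indeterminate r_1..r_d and generic
   l, is symmetric in the r_i since T is commutative, hence is a point over the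
   rational function field in the coefficients of l and the elementary symmetric
   functions of the r_i; specializing the r_i to the conjugates of t gives x^d,
   since V(l(t)) = x forces V(l(t_i)) = x for each conjugate t_i.  Climbing down
   a tower of simple extensions, p-retract rationality gives that eta^d is
   liftable for some d prime to p; when this holds for all p, eta is liftable. *)

From HB Require Import structures.
From mathcomp Require Import all_boot all_algebra all_field.
From mathcomp Require Import perm mpoly.
Require Import Defs.
From Stdlib Require Import ClassicalEpsilon FunctionalExtensionality ProofIrrelevance.

Set Implicit Arguments.
Unset Strict Implicit.
Unset Printing Implicit Defensive.

Import GRing.Theory.
Local Open Scope ring_scope.

(** * Choice and extensionality of ring morphisms *)

Lemma fun_choice (A B : Type) (P : A -> B -> Prop) :
  (forall x, exists y, P x y) -> exists f, forall x, P x (f x).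
Proof.
move=> ex; exists (fun x => proj1_sig (constructive_indefinite_description _ (ex x))) => x.
by case: constructive_indefinite_description.
Qed.

Lemma rmorph_ext (R S : pzSemiRingType) (f g : {rmorphism R -> S}) : f =1 g -> f = g.
Proof.
case: f g => [f cf] [g cg] /= /functional_extensionality fg.
by subst g; congr GRing.RMorphism.Pack; case: cf cg => [[?] [?]] [[?] [?]];
  f_equal; f_equal; apply: proof_irrelevance.
Qed.

(** * Points *)

Section Points.
Variables (k : fieldType) (X : affVariety k).

Lemma point_ext (R : comNzRingType) (r : {rmorphism k -> R}) (a b : point X r) :
  pt a =1 pt b -> a = b.
Proof.
case: a b => [a ha] [b hb] /= /rmorph_ext ab; subst b.
by congr Point; apply: proof_irrelevance.
Qed.

Section Push.
Variables (R S : comNzRingType) (r : {rmorphism k -> R}) (s : {rmorphism k -> S}).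
Variables (h : {rmorphism R -> S}) (hrs : h \o r =1 s).

Lemma push_cst (a : point X r) (c : k) : (h \o pt a)%FUN (cst X c) = s c.
Proof. by rewrite /= pt_cst -hrs. Qed.

Definition push (a : point X r) : point X s := Point (push_cst a).

Lemma push_toP (a : point X r) (b : point X s) : push_to h a b <-> b = push a.
Proof. by split=> [ab|-> //]; apply: point_ext => x; rewrite ab. Qed.

Lemma push_inj : injective h -> injective push.
Proof.
by move=> injh a b ab; apply: point_ext => x; apply: injh; move: (congr1 (fun p => pt p x) ab).
Qed.
End Push.

Section PairPoint.
Variables (R S : comNzRingType) (r : {rmorphism k -> R}) (s : {rmorphism k -> S}).

Definition pair_hom (U : comNzRingType) (f : {rmorphism U -> R}) (g : {rmorphism U -> S})
  (x : U) : R * S := (f x, g x).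

Section Hom.
Variables (U : comNzRingType) (f : {rmorphism U -> R}) (g : {rmorphism U -> S}).
Fact pair_hom_zmod : zmod_morphism (pair_hom f g).
Proof. by move=> x y; rewrite /pair_hom !rmorphB. Qed.
Fact pair_hom_monoid : monoid_morphism (pair_hom f g).
Proof. by split=> [|x y]; rewrite /pair_hom ?rmorph1 ?rmorphM. Qed.
HB.instance Definition _ :=
  GRing.isZmodMorphism.Build U (R * S)%type (pair_hom f g) pair_hom_zmod.
HB.instance Definition _ :=
  GRing.isMonoidMorphism.Build U (R * S)%type (pair_hom f g) pair_hom_monoid.
End Hom.

Fact pair_point_cst (a : point X r) (b : point X s) c :
  pair_hom (pt a) (pt b) (cst X c) = pair_hom r s c.
Proof. by rewrite /pair_hom !pt_cst. Qed.

Definition pair_point (a : point X r) (b : point X s) : point X (pair_hom r s) :=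
  Point (pair_point_cst a b).
End PairPoint.
End Points.

Section GroupPoints.
Variables (k : fieldType) (G : groupVariety k).

Section Basics.
Variables (R : comNzRingType) (r : {rmorphism k -> R}).
Local Notation "x * y" := (@gmul _ G R r x y).
Local Notation "1" := (@gone _ G R r).
Local Notation "x ^-1" := (@ginv _ G R r x).
Implicit Types x y z : point (gvar G) r.

(** Only a left unit and left inverses are given; cancelling an idempotent yields the right inverse,
    and later that [push] preserves the unit. *)
Lemma gmul_idem x : x * x = x -> x = 1.
Proof. by move=> xx; rewrite -(gmulV x) -{3}xx gmulA gmulV gmul1. Qed.

Lemma gmulgV x : x * x^-1 = 1.
Proof. by apply: gmul_idem; rewrite -gmulA (gmulA x^-1) gmulV gmul1. Qed.

Lemma gmulg1 x : x * 1 = x.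
Proof. by rewrite -(gmulV x) gmulA gmulgV gmul1. Qed.

Lemma ginv_uniq x y : x * y = 1 -> x = y^-1.
Proof. by move=> xy; rewrite -(gmulg1 x) -(gmulgV y) gmulA xy gmul1. Qed.

Definition gpow x (n : nat) := iter n (gmul x) 1.

Lemma gpowS x n : gpow x n.+1 = x * gpow x n.
Proof. by []. Qed.

Lemma gpowD x m n : gpow x (m + n) = gpow x m * gpow x n.
Proof. by elim: m => [|m IH]; rewrite ?gmul1 // addSn !gpowS IH gmulA. Qed.

Lemma gpowM x m n : gpow x (m * n) = gpow (gpow x m) n.
Proof. by elim: n => [|n IH]; rewrite ?muln0 // mulnS gpowD IH gpowS. Qed.
End Basics.

Section Push.
Variables (R S : comNzRingType) (r : {rmorphism k -> R}) (s : {rmorphism k -> S}).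
Variables (h : {rmorphism R -> S}) (hrs : h \o r =1 s).
Local Notation push := (@push k (gvar G) R S r s h hrs).

Lemma pushM a b : push (gmul a b) = gmul (push a) (push b).
Proof. by apply/esym/(push_toP hrs)/gmul_natural. Qed.

Lemma push1 : push (gone G r) = gone G s.
Proof. by apply: gmul_idem; rewrite -pushM gmul1. Qed.

Lemma pushV a : push (ginv a) = ginv (push a).
Proof. by apply: ginv_uniq; rewrite -pushM gmulV push1. Qed.

Lemma push_pow a n : push (gpow a n) = gpow (push a) n.
Proof. by elim: n => [|n IH]; rewrite ?push1 // !gpowS pushM IH. Qed.

Lemma push_prod (I : Type) (t : seq I) (V : I -> point (gvar G) r) :
  push (\big[@gmul _ G R r/gone G r]_(i <- t) V i) =
  \big[@gmul _ G S s/gone G s]_(i <- t) push (V i).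
Proof. by apply: (big_morph push pushM push1). Qed.
End Push.
End GroupPoints.

(** * Subrings defined by propositional predicates *)

Section Subring.
Variables (R : comNzRingType) (P : R -> Prop).
Hypotheses (P1 : P 1) (PB : forall x y, P x -> P y -> P (x - y))
  (PM : forall x y, P x -> P y -> P (x * y)).

Definition subring_pred : pred R := fun x =>
  if excluded_middle_informative (P x) then true else false.

Lemma subring_predP x : reflect (P x) (x \in subring_pred).
Proof.
by rewrite unfold_in /subring_pred; case: excluded_middle_informative; constructor.
Qed.

Fact subring_pred_closed : subring_closed subring_pred.
Proof.
split; first exact/subring_predP.
  by move=> x y /subring_predP hx /subring_predP hy; apply/subring_predP/PB.
by move=> x y /subring_predP hx /subring_predP hy; apply/subring_predP/PM.
Qed.

(* The proofs are arguments so that the ring structure depends on them. *)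
Definition subring_of := let _ := subring_pred_closed in {x : R | x \in subring_pred}.
HB.instance Definition _ := SubType.on subring_of.
HB.instance Definition _ := Choice.on subring_of.
HB.instance Definition _ :=
  GRing.SubChoice_isSubComNzRing.Build R _ subring_of subring_pred_closed.
End Subring.

(** Chosen preimages under the injective [h] are unique, hence additive and multiplicative. *)
Lemma rmorph_factor (U R S : comNzRingType) (f : {rmorphism U -> S})
    (h : {rmorphism R -> S}) :
  injective h -> (forall x, exists y, h y = f x) ->
  exists g : {rmorphism U -> R}, h \o g =1 f.
Proof.
move=> injh /fun_choice[g gE].
have gB : zmod_morphism g by move=> x y; apply: injh; rewrite rmorphB !gE rmorphB.
have gM : monoid_morphism g.
  by split=> [|x y]; apply: injh; rewrite ?rmorph1 ?rmorphM !gE ?rmorph1 ?rmorphM.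
pose gz := GRing.isZmodMorphism.Build U R g gB.
pose gm := GRing.isMonoidMorphism.Build U R g gM.
by pose g' : {rmorphism U -> R} := HB.pack g gz gm; exists g'.
Qed.

(* The group law is only given through points over rings, so that a product of
   points with values in a subring is computed over that subring. *)
Section Closure.
Variables (k : fieldType) (G : groupVariety k) (R : comNzRingType) (r : {rmorphism k -> R}).
Variable P : R -> Prop.
Hypotheses (P1 : P 1) (PB : forall x y, P x -> P y -> P (x - y))
  (PM : forall x y, P x -> P y -> P (x * y)) (Pr : forall c, P (r c)).

Definition valued_in (X : affVariety k) (a : point X r) := forall x, P (pt a x).

Let S := subring_of P1 PB PM.
Let incl : {rmorphism S -> R} := val.

Lemma subring_cst : exists s : {rmorphism k -> S}, incl \o s =1 r.
Proof.
apply: (@rmorph_factor _ S R r incl val_inj) => c.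
by exists (exist _ (r c) (introT (subring_predP P _) (Pr c))).
Qed.

Lemma valued_in_push (s : {rmorphism k -> S}) (hs : incl \o s =1 r) (a : point (gvar G) r) :
  valued_in a <-> exists b : point (gvar G) s, a = push hs b.
Proof.
split=> [Pa|[b -> x] /=]; last by apply/subring_predP/valP.
have [|g gE] := @rmorph_factor _ S R (pt a) incl val_inj.
  by move=> x; exists (exist _ (pt a x) (introT (subring_predP P _) (Pa x))).
have gc c : g (cst _ c) = s c.
  by apply: val_inj; rewrite [LHS]gE pt_cst; apply/esym/hs.
by exists (Point gc); apply: point_ext => x /=; rewrite -[LHS]gE.
Qed.

Lemma valued_in_gmul (a b : point (gvar G) r) :
  valued_in a -> valued_in b -> valued_in (gmul a b).
Proof.
have [s hs] := subring_cst; rewrite !(valued_in_push hs) => -[a' ->] [b' ->].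
by exists (gmul a' b'); rewrite pushM.
Qed.

Lemma valued_in_gone : valued_in (gone G r).
Proof.
by have [s hs] := subring_cst; rewrite (valued_in_push hs); exists (gone G s); rewrite push1.
Qed.

Lemma valued_in_ginv (a : point (gvar G) r) : valued_in a -> valued_in (ginv a).
Proof.
have [s hs] := subring_cst; rewrite !(valued_in_push hs) => -[a' ->].
by exists (ginv a'); rewrite pushV.
Qed.
End Closure.

Section PairClosure.
Variables (k : fieldType) (G : groupVariety k) (R S : comNzRingType).
Variables (r : {rmorphism k -> R}) (s : {rmorphism k -> S}) (P : R -> S -> Prop).
Hypotheses (P1 : P 1 1)
  (PB : forall x y x' y', P x x' -> P y y' -> P (x - y) (x' - y'))
  (PM : forall x y x' y', P x x' -> P y y' -> P (x * y) (x' * y'))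
  (Pr : forall c, P (r c) (s c)).

Definition related (X : affVariety k) (a : point X r) (b : point X s) :=
  forall x, P (pt a x) (pt b x).

Let Q (z : R * S) := P z.1 z.2.
Let QB x y : Q x -> Q y -> Q (x - y). Proof. exact: PB. Qed.
Let QM x y : Q x -> Q y -> Q (x * y). Proof. exact: PM. Qed.

Let fstP : @fst R S \o pair_hom r s =1 r. Proof. by []. Qed.
Let sndP : @snd R S \o pair_hom r s =1 s. Proof. by []. Qed.

Lemma valued_in_pair (X : affVariety k) (c : point X (pair_hom r s)) :
  valued_in Q c <-> related (push fstP c) (push sndP c).
Proof. by []. Qed.

(** The relation [P] is a subring of [R * S]. Two related points form one point over [R * S] valued
    in that subring, and the projections carry the product taken there to the products over [R] and
    [S]. *)
Lemma related_gmul (a a' : point (gvar G) r) (b b' : point (gvar G) s) :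
  related a b -> related a' b' -> related (gmul a a') (gmul b b').
Proof.
move=> ab ab'.
have := @valued_in_gmul k G _ (pair_hom r s) Q P1 QB QM Pr
  (pair_point a b) (pair_point a' b') ab ab'.
move/valued_in_pair; rewrite !pushM.
by congr (related (gmul _ _) (gmul _ _)); apply: point_ext.
Qed.

Lemma related_gone : related (gone G r) (gone G s).
Proof.
have := @valued_in_gone k G _ (pair_hom r s) Q P1 QB QM Pr.
by move/valued_in_pair; rewrite !push1.
Qed.

Lemma related_ginv (a : point (gvar G) r) (b : point (gvar G) s) :
  related a b -> related (ginv a) (ginv b).
Proof.
move=> ab.
have := @valued_in_ginv k G _ (pair_hom r s) Q P1 QB QM Pr (pair_point a b) ab.
move/valued_in_pair; rewrite !pushV.
by congr (related (ginv _) (ginv _)); apply: point_ext.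
Qed.
End PairClosure.

(** * Specialization of rational functions *)

Lemma frac_numden (D : idomainType) (z : {fraction D}) :
  z * (\d_(repr z))%:F = (\n_(repr z))%:F.
Proof.
have d0 : \d_(repr z) != 0 by apply: denom_ratioP.
rewrite -[X in X * _ = _](reprK z); unlock tofrac; rewrite -[LHS]pi_mul.
apply/eqmodP/eqP; rewrite /FracField.mulf !numden_Ratio ?mulf_neq0 ?oner_eq0 //.
by rewrite !mulr1 mulrC.
Qed.

Lemma fracP (D : idomainType) (z : {fraction D}) :
  exists a b : D, b != 0 /\ z = a%:F / b%:F.
Proof.
exists \n_(repr z), \d_(repr z); split; first exact: denom_ratioP.
by rewrite -frac_numden mulfK // tofrac_eq0 denom_ratioP.
Qed.

Section FracLift.
Variables (D : idomainType) (E : fieldType) (h : {rmorphism D -> E}) (injh : injective h).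

(* On [h := tofrac \o comorph f] this is [funfield_map f], definitionally. *)
Definition frac_lift (z : {fraction D}) : E := h \n_(repr z) / h \d_(repr z).

Lemma frac_liftE a b : b != 0 -> frac_lift (a%:F / b%:F) = h a / h b.
Proof.
move=> b0; rewrite /frac_lift; set z := a%:F / b%:F.
have d0 : \d_(repr z) != 0 by apply: denom_ratioP.
have hz := frac_numden z.
have hneq0 c : c != 0 -> h c != 0 by rewrite -(inj_eq injh) rmorph0.
apply/eqP; rewrite eqr_div ?hneq0 // -!rmorphM; apply/eqP; congr (h _); apply/eqP.
by rewrite -tofrac_eq !tofracM -hz /z mulrAC divfK ?tofrac_eq0.
Qed.

Fact frac_lift_zmod : zmod_morphism frac_lift.
Proof.
move=> x y; have [a [b [b0 ->]]] := fracP x; have [c [d [d0 ->]]] := fracP y.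
have hneq0 u : u != 0 -> h u != 0 by rewrite -(inj_eq injh) rmorph0.
rewrite -mulNr addf_div ?tofrac_eq0 // -tofracN -!tofracM -tofracD !frac_liftE ?mulf_neq0 //.
by rewrite rmorphD !rmorphM rmorphN -mulNr addf_div ?hneq0.
Qed.

Fact frac_lift_monoid : monoid_morphism frac_lift.
Proof.
split=> [|x y]; first by rewrite -[1]divr1 -tofrac1 frac_liftE ?oner_eq0 // rmorph1 divr1.
have [a [b [b0 ->]]] := fracP x; have [c [d [d0 ->]]] := fracP y.
have hneq0 u : u != 0 -> h u != 0 by rewrite -(inj_eq injh) rmorph0.
by rewrite mulf_div -!tofracM !frac_liftE ?mulf_neq0 // !rmorphM mulf_div.
Qed.

Definition frac_map : {rmorphism {fraction D} -> E} :=
  HB.pack frac_lift (GRing.isZmodMorphism.Build _ _ _ frac_lift_zmod)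
    (GRing.isMonoidMorphism.Build _ _ _ frac_lift_monoid).

Lemma frac_mapE : frac_map =1 frac_lift. Proof. by []. Qed.

Lemma frac_map_tofrac a : frac_map a%:F = h a.
Proof. by rewrite -[a%:F]divr1 -tofrac1 frac_mapE frac_liftE ?oner_eq0 // rmorph1 divr1. Qed.
End FracLift.

(* [f] is regular on the principal open subset of [g], and specializes to [w]
   there under [ev]. *)
Definition spec (D : idomainType) (E : fieldType) (ev : D -> E) (g : D)
    (f : {fraction D}) (w : E) : Prop :=
  exists (a : D) (m : nat), f = a%:F / g%:F ^+ m /\ w = ev a / ev g ^+ m.

Section Spec.
Variables (D : idomainType) (E : fieldType) (ev : {rmorphism D -> E}).
Implicit Types (g h : D) (f : {fraction D}) (w : E).

Lemma ev_neq0 g : ev g != 0 -> g%:F != 0.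
Proof. by rewrite tofrac_eq0; apply: contra_neq => ->; rewrite rmorph0. Qed.

Lemma specP g f w : ev g != 0 ->
  spec ev g f w <-> exists a m, f * g%:F ^+ m = a%:F /\ w * ev g ^+ m = ev a.
Proof.
move=> g0; have gF := ev_neq0 g0.
split=> -[a [m [hf hw]]]; exists a, m; split.
- by rewrite hf divfK // expf_neq0.
- by rewrite hw divfK // expf_neq0.
- by rewrite -hf mulfK // expf_neq0.
- by rewrite -hw mulfK // expf_neq0.
Qed.

Lemma spec_tofrac g a : spec ev g a%:F (ev a).
Proof. by exists a, 0%N; rewrite !expr0 !divr1. Qed.

Lemma specB g f f' w w' : ev g != 0 ->
  spec ev g f w -> spec ev g f' w' -> spec ev g (f - f') (w - w').
Proof.
move=> g0 /(specP _ _ g0)[a [m [hf hw]]] /(specP _ _ g0)[b [l [hf' hw']]].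
apply/specP => //; exists (a * g ^+ l - b * g ^+ m), (m + l)%N.
rewrite tofracB !tofracM !tofracXn rmorphB !rmorphM !rmorphXn -hf -hw -hf' -hw'.
by rewrite !mulrBl !exprD !mulrA [_ * g%:F ^+ l * _]mulrAC [_ * ev g ^+ l * _]mulrAC.
Qed.

Lemma specM g f f' w w' : ev g != 0 ->
  spec ev g f w -> spec ev g f' w' -> spec ev g (f * f') (w * w').
Proof.
move=> g0 /(specP _ _ g0)[a [m [hf hw]]] /(specP _ _ g0)[b [l [hf' hw']]].
apply/specP => //; exists (a * b), (m + l)%N.
by rewrite tofracM rmorphM -hf -hw -hf' -hw' !exprD; split; rewrite mulrACA.
Qed.

Lemma spec1 g : spec ev g 1 1.
Proof. by rewrite -tofrac1 -(rmorph1 ev); apply: spec_tofrac. Qed.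

Lemma specW g h f w : ev h != 0 -> ev g != 0 ->
  spec ev g f w -> spec ev (g * h) f w.
Proof.
move=> h0 g0 /(specP _ _ g0)[a [m [hf hw]]]; apply/specP; first by rewrite rmorphM mulf_neq0.
exists (a * h ^+ m), m.
by rewrite !tofracM !rmorphM !tofracXn !rmorphXn !exprMn !mulrA -hf -hw.
Qed.

(** Two representations of [f] over powers of [g] can be cross-multiplied inside [D], and [ev]
    preserves the resulting equality. *)
Lemma spec_uniq g f w w' : ev g != 0 -> spec ev g f w -> spec ev g f w' -> w = w'.
Proof.
move=> g0 /(specP _ _ g0)[a [m [hf hw]]] /(specP _ _ g0)[b [l [hf' hw']]].
have ab : a * g ^+ l = b * g ^+ m.
  by apply/eqP; rewrite -tofrac_eq !tofracM !tofracXn -hf -hf' mulrAC.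
apply: (mulIf (expf_neq0 (m + l) g0)).
by rewrite {1}exprD exprD [ev g ^+ m * _ in RHS]mulrC !mulrA hw hw' -!rmorphXn -!rmorphM ab.
Qed.

(** Values of specializations are unique, so choosing them gives a ring morphism. *)
Lemma spec_hom (A : comNzRingType) g (V : {rmorphism A -> {fraction D}}) :
  ev g != 0 -> (forall c, exists w, spec ev g (V c) w) ->
  exists x : {rmorphism A -> E}, forall c, spec ev g (V c) (x c).
Proof.
move=> g0 /fun_choice[x xE].
have xB : zmod_morphism x.
  by move=> a b; apply: spec_uniq (xE _) _; rewrite // rmorphB; apply: specB.
have xM : monoid_morphism x.
  split=> [|a b]; apply: spec_uniq (xE _) _; rewrite // ?rmorph1 ?rmorphM.
    exact: spec1.
  exact: specM.
pose x' : {rmorphism A -> E} := HB.pack x (GRing.isZmodMorphism.Build _ _ _ xB)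
  (GRing.isMonoidMorphism.Build _ _ _ xM).
by exists x'.
Qed.
End Spec.

(** * Lifting points along an evaluation *)

Section Lifts.
Variables (k : fieldType) (D : idomainType) (E : fieldType).
Variables (kD : {rmorphism k -> D}) (ev : {rmorphism D -> E}) (r : {rmorphism k -> E}).
Hypothesis evk : ev \o kD =1 r.
Local Notation kF := (@tofrac D \o kD)%FUN.

(** This stands for a point over the localization of [D] at [g]: [V] has values in the fraction
    field, and [spec] records that they are regular where [g] does not vanish. *)
Definition lifts (X : affVariety k) (g : D) (V : point X kF) (x : point X r) : Prop :=
  ev g != 0 /\ related (spec ev g) V x.

Lemma spec_cst g c : spec ev g (kF c) (r c).
Proof. by rewrite -evk; apply: spec_tofrac. Qed.

Section Group.
Variable G : groupVariety k.
Implicit Types (V W : point (gvar G) kF) (x y : point (gvar G) r).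

Lemma lifts_gmul g h V W x y :
  lifts g V x -> lifts h W y -> lifts (g * h) (gmul V W) (gmul x y).
Proof.
move=> [g0 Vx] [h0 Wy]; have gh0 : ev (g * h) != 0 by rewrite rmorphM mulf_neq0.
split=> //; apply: (related_gmul (P := spec ev (g * h))) => //.
- exact: spec1.
- by move=> *; apply: specB.
- by move=> *; apply: specM.
- exact: spec_cst.
- by move=> c; apply: specW.
- by move=> c; rewrite mulrC; apply: specW.
Qed.

Lemma lifts_gone : lifts 1 (gone G kF) (gone G r).
Proof.
have g0 : ev 1 != 0 by rewrite rmorph1 oner_neq0.
split=> //; apply: (related_gone (P := spec ev 1)) => //.
- exact: spec1.
- by move=> *; apply: specB.
- by move=> *; apply: specM.
- exact: spec_cst.
Qed.

Lemma lifts_ginv g V x : lifts g V x -> lifts g (ginv V) (ginv x).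
Proof.
move=> [g0 Vx]; split=> //; apply: (related_ginv (P := spec ev g)) => //.
- exact: spec1.
- by move=> *; apply: specB.
- by move=> *; apply: specM.
- exact: spec_cst.
Qed.

Lemma lifts_prod (I : Type) (t : seq I) (g : I -> D) (V : I -> point (gvar G) kF)
    (x : I -> point (gvar G) r) :
  (forall i, lifts (g i) (V i) (x i)) ->
  lifts (\prod_(i <- t) g i) (\big[@gmul _ G _ kF/gone G kF]_(i <- t) V i)
    (\big[@gmul _ G _ r/gone G r]_(i <- t) x i).
Proof.
move=> Vx; elim: t => [|i t IH]; rewrite ?big_nil ?big_cons; first exact: lifts_gone.
exact: lifts_gmul.
Qed.
End Group.
End Lifts.

(** A [phi] with a kernel does not extend to fraction fields. It does extend to fractions over
    powers of [g], since [phi g] is nonzero, and these contain the values of [V]. The last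
    conclusion determines [V']. *)
Lemma lifts_base (k : fieldType) (X : affVariety k) (D D' : idomainType) (E : fieldType)
    (kD : {rmorphism k -> D}) (kD' : {rmorphism k -> D'}) (r : {rmorphism k -> E})
    (ev : {rmorphism D -> E}) (ev' : {rmorphism D' -> E}) (phi : {rmorphism D -> D'})
    (g : D) (V : point X (@tofrac D \o kD)%FUN) (x : point X r) :
  ev' \o phi =1 ev -> phi \o kD =1 kD' -> lifts ev g V x ->
  exists V' : point X (@tofrac D' \o kD')%FUN,
    lifts ev' (phi g) V' x /\ related (spec (@tofrac D' \o phi)%FUN g) V V'.
Proof.
move=> evE kE [g0 Vx].
have g0' : ev' (phi g) != 0 by move: (evE g) => /= ->.
have gF : (@tofrac D' \o phi)%FUN g != 0 := ev_neq0 g0'.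
have [|V' VV'] := spec_hom (V := pt V) gF.
  by move=> c; have [a [m [-> _]]] := Vx c; eexists; exists a, m.
have V'k c : V' (cst X c) = (kD' c)%:F.
  apply: (spec_uniq gF (VV' _)); rewrite pt_cst -(kE c).
  exact: (spec_tofrac (@tofrac D' \o phi)%FUN).
exists (Point (V'k : forall c, V' (cst X c) = (@tofrac D' \o kD')%FUN c)); split=> //.
split=> // c /=; have [a [m [Vc xc]]] := Vx c.
exists (phi a), m; split; last by rewrite xc -!evE.
by apply: (spec_uniq gF (VV' c)); exists a, m.
Qed.

Lemma mpoly_rmorph_ext (R S : comNzRingType) n (f g : {rmorphism {mpoly R[n]} -> S}) :
  (forall c, f c%:MP = g c%:MP) -> (forall i, f 'X_i = g 'X_i) -> f =1 g.
Proof.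
move=> fgC fgX p; rewrite (mpolyE p) !rmorph_sum; apply: eq_bigr => m _.
rewrite -mul_mpolyC !rmorphM fgC; congr (_ * _).
rewrite mpolyXE_id !rmorph_prod; apply: eq_bigr => i _.
by rewrite !rmorphXn fgX.
Qed.

(** * Liftable points *)

Section Liftable.
Variables (k : fieldType) (E : fieldType) (r : {rmorphism k -> E}) (K : {pred E}).

(** The predicate [K] bounds only the coordinates of [u], so that a tower of subfields can be
    descended inside a fixed field [E]. *)
Definition liftable (X : affVariety k) (x : point X r) : Prop :=
  exists (n : nat) (u : 'I_n -> E) (g : {mpoly k[n]})
    (V : point X (@tofrac _ \o @mpolyC n k)%FUN),
    (forall i, u i \in K) /\ lifts (mmap r u) g V x.

Lemma mmap_cst n (u : 'I_n -> E) : mmap r u \o @mpolyC n k =1 r.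
Proof. by move=> c; rewrite /= mmapC. Qed.

Variable G : groupVariety k.
Implicit Types x y : point (gvar G) r.

(** The two lifts are moved to disjoint blocks of variables and multiplied there. *)
Lemma liftable_gmul x y : liftable x -> liftable y -> liftable (gmul x y).
Proof.
move=> [n [u [g [V [uK Vx]]]]] [m [v [h [W [vK Wy]]]]].
pose w (i : 'I_(n + m)) := match split i with inl j => u j | inr j => v j end.
pose phi : {rmorphism _ -> _} := mmap (@mpolyC (n + m) k) (fun i => 'X_(lshift m i)).
pose psi : {rmorphism _ -> _} := mmap (@mpolyC (n + m) k) (fun i => 'X_(rshift n i)).
have phiE : mmap r w \o phi =1 mmap r u.
  apply: mpoly_rmorph_ext => [c|i] /=; rewrite /phi ?mmapC // !mmapX !mmap1U.
  by rewrite mmapX mmap1U /w -[lshift m i]/(unsplit (inl i)) unsplitK.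
have psiE : mmap r w \o psi =1 mmap r v.
  apply: mpoly_rmorph_ext => [c|i] /=; rewrite /psi ?mmapC // !mmapX !mmap1U.
  by rewrite mmapX mmap1U /w -[rshift n i]/(unsplit (inr i)) unsplitK.
have [V' [V'x _]] := lifts_base (kD' := @mpolyC (n + m) k) phiE (fun c => mmapC _ _ c) Vx.
have [W' [W'y _]] := lifts_base (kD' := @mpolyC (n + m) k) psiE (fun c => mmapC _ _ c) Wy.
exists (n + m)%N, w, (phi g * psi h), (gmul V' W'); split.
  by move=> i; rewrite /w; case: split.
by apply: lifts_gmul => //; apply: mmap_cst.
Qed.

Lemma liftable_ginv x : liftable x -> liftable (ginv x).
Proof.
move=> [n [u [g [V [uK Vx]]]]]; exists n, u, g, (ginv V); split=> //.
by apply: lifts_ginv => //; apply: mmap_cst.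
Qed.
End Liftable.

(** * Splitting fields and commutativity *)

Lemma irreducible_divisor (F : fieldType) (p : {poly F}) :
  (1 < size p)%N -> exists2 q : {poly F}, irreducible_poly q & q %| p.
Proof.
have [n] := ubnP (size p); elim: n p => // n IH p; rewrite ltnS => pn p1.
have [irr|] := classic (irreducible_poly p); first by exists p.
move=> nirr; have [q nq] : exists q : {poly F}, ~ (size q != 1 -> q %| p -> q %= p).
  by apply: not_all_ex_not => irr; apply: nirr; split.
have [q1 nq1] := imply_to_and _ _ nq; have [qp /negP nqp] := imply_to_and _ _ nq1.
have p0 : p != 0 by rewrite -size_poly_gt0 ltnW.
have q0 : q != 0 by apply: contraTneq qp => ->; rewrite dvd0p.
have ltqp : (size q < size p)%N.
  by rewrite ltn_neqAle (dvdp_leq p0 qp) andbT dvdp_size_eqp.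
have [||s irrs sq] := IH q; first exact: leq_trans ltqp pn.
  by rewrite ltn_neqAle eq_sym q1 size_poly_gt0.
by exists s => //; apply: dvdp_trans sq qp.
Qed.

(** Adjoin a root of an irreducible factor, divide by the linear factor found, and recurse over the
    larger field. *)
Lemma splitting_field (F : fieldType) (p : {poly F}) : p \is monic ->
  exists (E : fieldType) (j : {rmorphism F -> E}) (rs : seq E),
    map_poly j p = \prod_(z <- rs) ('X - z%:P).
Proof.
have [n] := ubnP (size p); elim: n F p => // n IH F p; rewrite ltnS => pn pm.
have [p1|p1] := leqP (size p) 1.
  exists F, idfun, [::]; rewrite big_nil map_poly_id //.
  by move: (monicP pm); rewrite {1}(size1_polyC p1) lead_coefC {2}(size1_polyC p1) => ->.
have [q irrq qp] := irreducible_divisor p1.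
have [L _ [z qz _]] := irredp_FAdjoin irrq.
have /factor_theorem[s ps] : root (map_poly (in_alg L) p) z.
  by apply: (root_dvdp _ qz); rewrite dvdp_map.
have sm : s \is monic by rewrite -(monicMr _ (monicXsubC z)) -ps map_monic.
have [|E [j [rs srs]]] := IH L s _ sm.
  move: pn; rewrite -(size_map_poly (in_alg L)) ps size_Mmonic ?monicXsubC ?monic_neq0 //.
  by rewrite size_XsubC addn2.
exists E, (j \o in_alg L)%FUN, (j z :: rs).
by rewrite map_poly_comp ps rmorphM /= map_polyXsubC srs big_cons mulrC.
Qed.

(** The group of points over [R] embeds in that over the [K]-algebra [E], where [theta] identifies
    it with tuples multiplied coordinatewise. *)
Lemma split_gmulC (k : fieldType) (T : groupVariety k) n (K : fieldType)
    (iota : {rmorphism k -> K}) (R E : comNzRingType) (r : {rmorphism k -> R})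
    (s : {rmorphism K -> E}) (h : {rmorphism R -> E}) :
  split_over T n iota -> injective h -> h \o r =1 s \o iota ->
  commutative (@gmul _ T R r).
Proof.
move=> [theta [injt _ mult _]] injh hrs a b.
apply: (push_inj (hrs := (hrs : h \o r =1 (s \o iota)%FUN)) injh).
rewrite !pushM; apply: injt; rewrite !mult.
by apply/ffunP => i; rewrite !ffunE mulrC.
Qed.

Lemma map_mpoly_inj (n : nat) (R S : comNzRingType) (f : {rmorphism R -> S}) :
  injective f -> injective (map_mpoly f : {mpoly R[n]} -> {mpoly S[n]}).
Proof.
by move=> injf p q pq; apply/mpolyP => m; apply: injf; rewrite -!mcoeff_map_mpoly pq.
Qed.

Lemma tofrac_inj (D : idomainType) : injective (@tofrac D).
Proof. by move=> a b /eqP; rewrite tofrac_eq => /eqP. Qed.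

Section Embedding.
Variables (k : fieldType) (K : fieldType) (iota : {rmorphism k -> K}).

(* Makes [T(Frac D)] a subgroup of [T(Frac D')], which is a torus split over [K]
   and hence commutative; no compositum of [K] and [Frac D] is needed. *)
Definition embeds (D : idomainType) (kD : {rmorphism k -> D}) : Prop :=
  exists (D' : idomainType) (s : {rmorphism K -> D'}) (f : {rmorphism D -> D'}),
    injective f /\ f \o kD =1 s \o iota.

Lemma embeds_mpoly (D : idomainType) (kD : {rmorphism k -> D}) (n : nat) :
  embeds kD -> embeds (@mpolyC n D \o kD)%FUN.
Proof.
move=> [D' [s [f [injf fs]]]]; exists {mpoly D'[n]}, (@mpolyC n D' \o s)%FUN, (map_mpoly f).
split=> [|c]; first exact: map_mpoly_inj.
by rewrite /= map_mpolyC; congr (_%:MP); apply: fs.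
Qed.

Lemma embeds_affspace (n : nat) : embeds (cst (affspace k n)).
Proof.
exists (coord (affspace K n)), (cst (affspace K n)), (map_mpoly iota).
split=> [|c]; first exact/map_mpoly_inj/fmorph_inj.
by rewrite /= map_mpolyC.
Qed.

Lemma embeds_gmulC (T : groupVariety k) (n : nat) (D : idomainType) (kD : {rmorphism k -> D}) :
  split_over T n iota -> embeds kD ->
  commutative (@gmul _ T _ (@tofrac D \o kD)%FUN).
Proof.
move=> splitT [D' [s [f [injf fs]]]].
have injF : injective (@tofrac D' \o f)%FUN by apply: inj_comp injf; apply: tofrac_inj.
apply: (split_gmulC (h := frac_map injF) (s := (@tofrac D' \o s)%FUN) splitT).
  exact: fmorph_inj.
move=> c; rewrite -[LHS]/(frac_map injF (kD c)%:F) frac_map_tofrac.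
by congr (_ %:F); apply: fs.
Qed.
End Embedding.

(** * Norms of liftable points *)

Section SymmetricDescent.
Variables (k : fieldType) (X : affVariety k) (C : idomainType) (d : nat).
Variables (kC : {rmorphism k -> C}).
Local Notation D := {mpoly C[d]}.
Local Notation S := [tuple mesym d C i.+1 | i < d].
Local Notation kF := (@tofrac D \o (@mpolyC d C \o kC))%FUN.

Lemma msym_frac_inj (s : 'S_d) : injective (@tofrac D \o (msym s : {rmorphism D -> D}))%FUN.
Proof. by apply: inj_comp; [apply: tofrac_inj | apply: inj_msym]. Qed.

Definition msym_frac (s : 'S_d) : {rmorphism {fraction D} -> {fraction D}} :=
  frac_map (msym_frac_inj (s := s)).

Lemma mesym_frac_inj :
  injective (@tofrac D \o (comp_mpoly S : {rmorphism D -> D}))%FUN.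
Proof. by apply: inj_comp; [apply: tofrac_inj | apply: msym_fundamental_un]. Qed.

(** An invariant fraction over a power of the symmetric [g] has a symmetric numerator, which is a
    polynomial in the elementary symmetric functions. These are algebraically independent, so [W]
    factors through the fraction field they generate. *)
Lemma lifts_symmetric (E : fieldType) (r : {rmorphism k -> E}) (ev : {rmorphism D -> E})
    (g : D) (W : point X kF) (x : point X r) :
  g \is symmetric -> (forall s c, msym_frac s (pt W c) = pt W c) -> lifts ev g W x ->
  exists (h : D) (W' : point X kF),
    lifts (ev \o (comp_mpoly S : {rmorphism D -> D}))%FUN h W' x.
Proof.
move=> gs Ws [g0 Wx]; have gF := ev_neq0 g0.
have [h [hg _]] := sym_fundamental gs.
have as_comp c : exists (t : D) (m : nat),
    pt W c = (t \mPo S)%:F / g%:F ^+ m /\ pt x c = ev (t \mPo S) / ev g ^+ m.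
  have [a [m [Wa xa]]] := Wx c.
  have /sym_fundamental[t [ta _]] : a \is symmetric.
    apply/issymP => s; apply: tofrac_inj; have := Ws s c.
    rewrite Wa rmorphM fmorphV rmorphXn !frac_map_tofrac /= (issymP _ gs s).
    by apply: mulIf; rewrite invr_eq0 expf_neq0.
  by exists t, m; rewrite ta.
pose F := frac_map mesym_frac_inj.
have FE t m : F (t%:F / h%:F ^+ m) = (t \mPo S)%:F / g%:F ^+ m.
  by rewrite rmorphM fmorphV rmorphXn !frac_map_tofrac /= hg.
have injF : injective F by apply: fmorph_inj.
have [|W' W'E] := rmorph_factor (f := pt W) injF.
  by move=> c; have [t [m [-> _]]] := as_comp c; exists (t%:F / h%:F ^+ m); apply: FE.
have W'k c : W' (cst X c) = kF c.
  apply: injF; rewrite [LHS]W'E pt_cst -[RHS]/(F (kC c)%:MP%:F) frac_map_tofrac /=.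
  by rewrite comp_mpolyC.
exists h, (Point W'k); split; first by rewrite /= hg.
move=> c; have [t [m [Wc xc]]] := as_comp c; exists t, m; split; last by rewrite /= hg.
by apply: injF; rewrite FE -Wc; apply: W'E.
Qed.
End SymmetricDescent.

Section NormPoint.
Variables (k : fieldType) (T : groupVariety k) (B C : idomainType) (d : nat).
Variables (kB : {rmorphism k -> B}) (kC : {rmorphism k -> C}).
Local Notation D := {mpoly C[d]}.
Local Notation S := [tuple mesym d C i.+1 | i < d].
Local Notation kD := (@mpolyC d C \o kC)%FUN.
Local Notation kF := (@tofrac D \o kD)%FUN.
Variables (E : fieldType) (r : {rmorphism k -> E}) (ev : {rmorphism D -> E}).
Hypothesis evk : ev \o kD =1 r.
Hypothesis comm : commutative (@gmul _ T _ kF).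
Variables (phi : 'I_d -> {rmorphism B -> D}).
Hypothesis phik : forall i, phi i \o kB =1 kD.
Hypothesis phis : forall (s : 'S_d) i, msym s \o phi i =1 phi (s i).

(** [W] is the product of the transforms of [V] along the [phi i]. A permutation of the variables
    permutes the factors, and commutativity makes [W] invariant. *)
Lemma lifts_norm (g : B) (V : point (gvar T) (@tofrac B \o kB)%FUN) (x : point (gvar T) r) :
  (forall i, lifts (ev \o phi i)%FUN g V x) ->
  exists (h : D) (W : point (gvar T) kF),
    lifts (ev \o (comp_mpoly S : {rmorphism D -> D}))%FUN h W (gpow x d).
Proof.
move=> Vx.
have [Vi ViP] := fun_choice (fun i =>
  lifts_base (ev' := ev) (phi := phi i) (fun _ => erefl) (phik i) (Vx i)).
pose W := \big[@gmul _ T _ kF/gone T kF]_(i < d) Vi i.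
apply: (@lifts_symmetric _ _ C d kC _ _ ev (\prod_(i < d) phi i g) W).
- apply/issymP => s; rewrite rmorph_prod [RHS](reindex_inj (@perm_inj _ s)).
  by apply: eq_bigr => i _; apply: phis.
- move=> s c.
  have sk : msym_frac C s \o kF =1 kF.
    move=> a; rewrite -[LHS]/(msym_frac C s (kC a)%:MP%:F) frac_map_tofrac.
    by congr (_ %:F); apply: mmapC.
  (* Both sides are the specialization of [V] along [phi (s i)]. *)
  have Vis i : push sk (Vi i) = Vi (s i).
    have [[g0 _] Vii] := ViP i; have [[g0' _] Vsi] := ViP (s i).
    have gF : (@tofrac D \o phi (s i))%FUN g != 0 by exact: ev_neq0 g0'.
    apply: point_ext => a; apply: esym; apply: (spec_uniq gF (Vsi a)).
    have [b [m [-> Vb]]] := Vii a; exists b, m; split=> //.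
    rewrite -[LHS]/(msym_frac C s (pt (Vi i) a)) Vb rmorphM fmorphV rmorphXn.
    by rewrite !frac_map_tofrac /= -!phis.
  have WP : push sk W = W.
    rewrite /W push_prod (eq_bigr (fun i => Vi (s i))); last by move=> i _; apply: Vis.
    pose op : Monoid.com_law (gone T kF) := HB.pack (@gmul _ T _ kF)
      (Monoid.isComLaw.Build _ (gone T kF) (@gmul _ T _ kF)
        (@gmulA _ T _ kF) comm (@gmul1 _ T _ kF)).
    by rewrite [RHS](reindex_inj (op := op) (@perm_inj _ s)).
  by rewrite -[in RHS]WP.
- have -> : gpow x d = \big[@gmul _ T _ r/gone T r]_(i < d) x.
    by rewrite big_const_ord.
  by apply: lifts_prod => // i; case: (ViP i).
Qed.
End NormPoint.

(** * Evaluation at a conjugate of the generator *)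

Section Conjugates.
Variables (k : fieldType) (F : fieldType) (L : fieldExtType F) (r : {rmorphism k -> L}).
Variables (K : {subfield L}) (t : L) (rK : forall c, r c \in K).
Variables (E : fieldType) (j : {rmorphism L -> E}) (rho : E).
Hypothesis root_rho : root (map_poly j (minPoly K t)) rho.

Lemma minPoly_conj (q : {poly L}) :
  q \is a polyOver K -> q.[t] = 0 -> (map_poly j q).[rho] = 0.
Proof.
move=> qK /rootP qt; apply/rootP; apply: root_dvdp root_rho.
by rewrite dvdp_map minPoly_dvdp.
Qed.

Lemma conj_const (q : {poly L}) w :
  q \is a polyOver K -> w \in K -> q.[t] = w -> (map_poly j q).[rho] = j w.
Proof.
move=> qK wK qt; apply/eqP; rewrite -subr_eq0; apply/eqP.
have := @minPoly_conj (q - w%:P); rewrite rmorphB /= map_polyC !hornerE; apply.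
  by rewrite rpredB // polyOverC.
by rewrite qt subrr.
Qed.

(** The inverse of [q.[t]] is again a polynomial value [s.[t]] over [K]; since [q * s] takes the
    value 1 at [t], it does so at [rho]. *)
Lemma conj_neq0 (q : {poly L}) : q \is a polyOver K -> q.[t] != 0 -> (map_poly j q).[rho] != 0.
Proof.
move=> qK qt.
have /Fadjoin_polyP[s sK st] : (q.[t])^-1 \in <<K; t>>%VS.
  by rewrite rpredV mempx_Fadjoin.
have : (map_poly j (q * s)).[rho] = j 1.
  by apply: conj_const; rewrite ?rpredM ?rpred1 // hornerM -st mulfV.
rewrite rmorphM hornerM rmorph1; apply: contra_eq_neq => ->.
by rewrite mul0r eq_sym oner_neq0.
Qed.

Variables (n : nat) (u : 'I_n -> L) (uK : forall i, u i \in <<K; t>>%VS).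
Variable ev : {rmorphism {mpoly k[n]} -> E}.
Hypotheses (evC : forall c, ev c%:MP = j (r c))
  (evX : forall i, ev 'X_i = (map_poly j (Fadjoin_poly K t (u i))).[rho]).

(** [Q] substitutes for each variable the polynomial over [K] that expresses [u i] in terms of
    [t]. *)
Lemma conj_poly : exists Q : {rmorphism {mpoly k[n]} -> {poly L}}, forall P,
  [/\ Q P \is a polyOver K, (Q P).[t] = mmap r u P & (map_poly j (Q P)).[rho] = ev P].
Proof.
pose Q : {rmorphism {mpoly k[n]} -> {poly L}} :=
  mmap (@polyC L \o r)%FUN (fun i => Fadjoin_poly K t (u i)).
exists Q => P; split.
- rewrite /Q /= /mmap rpred_sum // => m _; rewrite rpredM ?polyOverC //=.
  by rewrite rpred_prod // => i _; rewrite rpredX // Fadjoin_polyOver.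
- move: P; apply: (mpoly_rmorph_ext (f := horner_eval t \o Q)%FUN) => [c|i] /=.
    by rewrite /Q /= !mmapC /= /horner_eval hornerC.
  by rewrite /Q /= !mmapX !mmap1U /horner_eval Fadjoin_poly_eq.
- move: P; apply: (mpoly_rmorph_ext (f := horner_eval rho \o (map_poly j \o Q))%FUN) => [c|i] /=.
    by rewrite /Q /= !mmapC /= /horner_eval map_polyC hornerC evC.
  by rewrite /Q /= !mmapX !mmap1U /horner_eval evX.
Qed.

(** As [pt x c] lies in [K], the equation saying that [V] has value [x] is a polynomial relation on
    [t] over [K], which the conjugate [rho] satisfies too. *)
Lemma lifts_conj (X : affVariety k) g (V : point X (@tofrac _ \o @mpolyC n k)%FUN)
    (x : point X r) (s : {rmorphism k -> E}) (js : j \o r =1 s) :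
  (forall c, pt x c \in K) -> lifts (mmap r u) g V x -> lifts ev g V (push js x).
Proof.
have [Q QP] := conj_poly; have Q_t P : (Q P).[t] = mmap r u P by case: (QP P).
have Q_rho P : (map_poly j (Q P)).[rho] = ev P by case: (QP P).
have Q_over P : Q P \is a polyOver K by case: (QP P).
move=> xK [g0 Vx]; have g0' : ev g != 0 by rewrite -Q_rho conj_neq0 // Q_t.
split=> // c; have [a [m [Va xa]]] := Vx c; exists a, m; split=> //.
apply: (canRL (mulfK (expf_neq0 m g0'))) => /=.
have : (map_poly j (Q a - (pt x c)%:P * Q g ^+ m)).[rho] = 0.
  apply: minPoly_conj; first by rewrite rpredB // rpredM ?polyOverC ?rpredX.
  by rewrite hornerD hornerN hornerM hornerC horner_exp !Q_t xa divfK ?subrr // expf_neq0.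
rewrite rmorphB rmorphM rmorphXn /= map_polyC hornerD hornerN hornerM hornerC horner_exp !Q_rho.
by move/eqP; rewrite subr_eq0 => /eqP ->.
Qed.
End Conjugates.

Lemma lifts_descend (k : fieldType) (X : affVariety k) (D : idomainType) (L E : fieldType)
    (kD : {rmorphism k -> D}) (r : {rmorphism k -> L}) (s : {rmorphism k -> E})
    (j : {rmorphism L -> E}) (js : j \o r =1 s) (ev : {rmorphism D -> L})
    (ev' : {rmorphism D -> E}) g (V : point X (@tofrac D \o kD)%FUN) (x : point X r) :
  j \o ev =1 ev' -> lifts ev' g V (push js x) -> lifts ev g V x.
Proof.
move=> jev [g0 Vx]; split; first by move: g0; rewrite -(jev g) /= fmorph_eq0.
move=> c; have [a [m [Va xa]]] := Vx c; exists a, m; split=> //.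
apply: (fmorph_inj j); rewrite rmorphM fmorphV rmorphXn.
by move: xa; rewrite -(jev a) -(jev g).
Qed.

Lemma mmap_mesym (R S : comNzRingType) (f : {rmorphism R -> S}) (d : nat)
    (v : 'I_d -> S) m :
  mmap f v (mesym d R m) = (mesym d S m).@[v].
Proof.
rewrite /mesym !rmorph_sum; apply: eq_bigr => h _.
by rewrite !rmorph_prod; apply: eq_bigr => i _; rewrite /= mevalXU mmapX mmap1U.
Qed.

Section SimpleExtension.
Variables (k : fieldType) (T : groupVariety k) (F : fieldType) (L : fieldExtType F).
Variables (r : {rmorphism k -> L}) (K : {subfield L}) (t : L) (rK : forall c, r c \in K).
Local Notation d := (adjoin_degree K t).

Lemma lifts_norm_simple (n : nat) (u : 'I_n -> L) g
    (V : point (gvar T) (@tofrac _ \o @mpolyC n k)%FUN) (x : point (gvar T) r)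
    (C : idomainType) (kC : {rmorphism k -> C}) (Z : 'I_n -> 'I_d -> C)
    (evC : {rmorphism C -> L}) :
  (forall i, u i \in <<K; t>>%VS) -> (forall c, pt x c \in K) ->
  lifts (mmap r u) g V x ->
  evC \o kC =1 r -> (forall i e, evC (Z i e) = (Fadjoin_poly K t (u i))`_e) ->
  commutative (@gmul _ T _ (@tofrac _ \o (@mpolyC d C \o kC))%FUN) ->
  exists (q : 'I_d -> L) h (W : point (gvar T) (@tofrac _ \o (@mpolyC d C \o kC))%FUN),
    (forall i, q i \in K) /\ lifts (mmap evC q) h W (gpow x d).
Proof.
move=> uK xK Vx evCk evCZ comm.
(* The conjugates are listed with multiplicity, so there are always [d] of them, even when [t] is
   inseparable. *)
have [E [j [rs Hrs]]] := splitting_field (monic_minPoly K t).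
have rs_size : size rs == d.
  by rewrite -eqSS -(size_minPoly K t) -(size_map_poly j) Hrs size_prod_XsubC.
pose cs := Tuple rs_size.
(* [phi i] substitutes the generic polynomials with coefficients [Z], evaluated at the i-th
   indeterminate root. *)
pose phi (i : 'I_d) : {rmorphism {mpoly k[n]} -> {mpoly C[d]}} :=
  mmap (@mpolyC d C \o kC)%FUN (fun l => \sum_(e < d) (Z l e)%:MP * 'X_i ^+ e).
have phik i : phi i \o @mpolyC n k =1 (@mpolyC d C \o kC)%FUN by move=> c; apply: mmapC.
have phis (s : 'S_d) i : msym s \o phi i =1 phi (s i).
  apply: (mpoly_rmorph_ext (f := msym s \o phi i)%FUN) => [c|l] /=.
    by rewrite /phi /= !mmapC /= /msym mmapC.
  rewrite /phi /= !mmapX !mmap1U rmorph_sum; apply: eq_bigr => e _.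
  by rewrite rmorphM rmorphXn /= /msym mmapC mmapX mmap1U.
pose ev : {rmorphism {mpoly C[d]} -> E} := mmap (j \o evC)%FUN (tnth cs).
have evk : ev \o (@mpolyC d C \o kC) =1 (j \o r)%FUN.
  by move=> c; rewrite /ev /= mmapC /=; congr (j _); apply: evCk.
pose js : j \o r =1 (j \o r)%FUN := fun _ => erefl.
have lc i : lifts (ev \o phi i)%FUN g V (push js x).
  have lc := @lifts_conj _ _ _ _ _ _ rK _ j (tnth cs i) _ _ _ uK (ev \o phi i)%FUN
    _ _ _ _ _ _ _ js xK Vx.
  apply: lc.
  - by rewrite Hrs root_prod_XsubC mem_tnth.
  - by move=> c; rewrite /= /phi mmapC; apply: evk.
  move=> l; rewrite /= /phi mmapX mmap1U rmorph_sum (@horner_coef_wide _ d); last first.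
    by rewrite size_map_poly size_Fadjoin_poly.
  apply: eq_bigr => e _; rewrite coef_map -evCZ rmorphM rmorphXn.
  by rewrite /ev /= mmapC mmapX mmap1U.
have [h [W Wx]] := lifts_norm evk comm phik phis lc.
(* By Vieta, [q i] is the value at the conjugates of the elementary symmetric function of degree
   [i.+1]; as a signed coefficient of the minimal polynomial it lies in [K]. *)
pose q (i : 'I_d) := (-1) ^+ i.+1 * (minPoly K t)`_(d - i.+1).
exists q, h, W; split.
  by move=> i; rewrite rpredM ?rpredX ?rpredN ?rpred1 //; apply/polyOverP/minPolyOver.
(* Those values already lie in [L], so the lift found over the splitting field descends. *)
rewrite -(push_pow js) in Wx; apply: lifts_descend Wx.
apply: (mpoly_rmorph_ext (f := j \o mmap evC q)%FUN) => [c|i] /=.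
  by rewrite comp_mpolyC /ev /= !mmapC.
rewrite mmapX mmap1U /comp_mpoly mmapX mmap1U tnth_mktuple /ev /= mmap_mesym.
have := mroots_coeff cs (lift ord0 i); rewrite lift0 -[\prod_(_ <- _) _]/(\prod_(z <- rs) _) -Hrs.
rewrite coef_map /q rmorphM rmorphXn rmorphN1 /= => ->.
by rewrite mulrA -exprD -signr_odd oddD addbb expr0 mul1r.
Qed.
End SimpleExtension.

(** * Descent of liftability along a finite extension *)

Section Norm.
Variables (k : fieldType) (T : groupVariety k) (hT : algebraic_torus T).
Variables (F : fieldType) (L : fieldExtType F).

Lemma liftable_norm (r : {rmorphism k -> L}) (K : {subfield L}) (t : L)
    (x : point (gvar T) r) :
  (forall c, r c \in K) -> (forall c, pt x c \in K) ->
  liftable <<K; t>>%VS x -> liftable K (gpow x (adjoin_degree K t)).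
Proof.
move=> rK xK [n [u [g [V [uK Vx]]]]]; set d := adjoin_degree K t.
have [m [Kc [iota [_ splitT]]]] := hT.
(* One variable of [C] for each coordinate of [u] and each power of [t] below [d]; [z] gives the
   actual coefficients. *)
pose N := #|{: 'I_n * 'I_d}|.
pose z (i : 'I_N) : L := (Fadjoin_poly K t (u (enum_val i).1))`_(enum_val i).2.
pose C : idomainType := coord (affspace k N).
pose kC : {rmorphism k -> C} := cst (affspace k N).
pose evC : {rmorphism C -> L} := mmap r z.
pose Z (l : 'I_n) (e : 'I_d) : C := 'X_(enum_rank (l, e)).
have comm := embeds_gmulC splitT (@embeds_mpoly k Kc iota C kC d (embeds_affspace iota N)).
have evCk : evC \o kC =1 r by apply: mmapC.
have evCZ i e : evC (Z i e) = (Fadjoin_poly K t (u i))`_e.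
  by rewrite /evC /Z /= mmapX mmap1U /z enum_rankK.
have [q [h [W [qK Wx]]]] := lifts_norm_simple rK uK xK Vx evCk evCZ comm.
(* The iterated ring [{mpoly C[d]}] is flattened to [N + d] variables over [k]: the coefficients,
   then the elementary symmetric functions. *)
pose w (i : 'I_(N + d)) := match split i with inl a => z a | inr b => q b end.
pose phiC : {rmorphism C -> {mpoly k[N + d]}} :=
  mmap (@mpolyC (N + d) k) (fun i => 'X_(lshift d i)).
pose phi : {rmorphism {mpoly C[d]} -> {mpoly k[N + d]}} :=
  mmap phiC (fun i => 'X_(rshift N i)).
have wC : mmap r w \o phiC =1 evC.
  apply: (mpoly_rmorph_ext (f := mmap r w \o phiC)%FUN) => [c|i]; rewrite /evC /phiC /=.
    by rewrite !mmapC.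
  by rewrite !mmapX !mmap1U mmapX mmap1U /w -[lshift d i]/(unsplit (inl i)) unsplitK.
have wE : mmap r w \o phi =1 mmap evC q.
  apply: (mpoly_rmorph_ext (f := mmap r w \o phi)%FUN) => [c|i]; rewrite /phi /=.
    by rewrite !mmapC; apply: wC.
  by rewrite !mmapX !mmap1U mmapX mmap1U /w -[rshift N i]/(unsplit (inr i)) unsplitK.
have phik : phi \o (@mpolyC d C \o kC) =1 @mpolyC (N + d) k.
  by move=> c; rewrite /phi /= mmapC; apply: mmapC.
have [W' [W'x _]] := lifts_base wE phik Wx.
exists (N + d)%N, w, (phi h), W'; split=> // i; rewrite /w; case: split => // a.
by rewrite /z; apply/polyOverP/Fadjoin_polyOver.
Qed.

Variable r : {rmorphism k -> F}.
Let rL : {rmorphism k -> L} := (in_alg L \o r)%FUN.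
Let rP : in_alg L \o r =1 rL := fun _ => erefl.
Implicit Type x : point (gvar T) r.

Lemma liftable_tower (ts : seq L) x :
  liftable <<1 & ts>>%VS (push rP x) ->
  liftable 1%VS (push rP (gpow x (\dim <<1 & ts>>%VS))).
Proof.
elim/last_ind: ts x => [|ts t IH] x.
  by rewrite Fadjoin_nil dimv1 gpowS /= gmulg1.
(* The last generator is removed first, at the cost of its degree as exponent; the induction
   hypothesis is applied to that power, and the degrees multiply to the dimension. *)
rewrite adjoin_rcons => Lx; rewrite dim_Fadjoin gpowM; apply: IH.
rewrite push_pow; apply: (liftable_norm (K := <<1 & ts>>%AS)) => // c.
  by rewrite rpredZ // rpred1.
by rewrite rpredZ // rpred1.
Qed.

(** A basis generates [L], so the tower starts from all of [L]; at its bottom the coordinates lie in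
    [1%VS], hence come from [F]. *)
Lemma liftable_ext x :
  liftable predT (push rP x) -> liftable predT (gpow x (\dim {:L})).
Proof.
have full : <<1 & vbasis {:L}>>%VS = {:L}%VS.
  apply/eqP; rewrite eqEsubv subvf /= -{1}(span_basis (vbasisP {:L})).
  by apply/span_subvP/seqv_sub_adjoin.
move=> [n [u [g [V [_ Vx]]]]].
have [|m [v [h [W [v1 Wx]]]]] := @liftable_tower (vbasis {:L}) x.
  by exists n, u, g, V; split=> // i; rewrite full memvf.
have [a va] := fun_choice (fun i => vlineP _ _ (v1 i)).
rewrite full in Wx; exists m, a, h, W; split=> //.
apply: lifts_descend Wx.
apply: (mpoly_rmorph_ext (f := in_alg L \o mmap r a)%FUN) => [c|i] /=.
  by rewrite !mmapC.
by rewrite !mmapX !mmap1U va.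
Qed.
End Norm.

(** * From has_degree to finite field extensions *)

(** An alias of [L] that carries the [F]-algebra structure induced by [iota]. *)
Definition field_over (F L : fieldType) (iota : {rmorphism F -> L}) : Type := L.

Section FieldOver.
Variables (F L : fieldType) (iota : {rmorphism F -> L}).
Local Notation LF := (field_over iota).

HB.instance Definition _ := GRing.Field.on LF.

Let scale (a : F) (x : LF) : LF := iota a * (x : L).

Fact field_over_scaleA a b (x : LF) : scale a (scale b x) = scale (a * b) x.
Proof. by rewrite /scale mulrA -rmorphM. Qed.
Fact field_over_scale1 : left_id 1 scale.
Proof. by move=> x; rewrite /scale rmorph1 mul1r. Qed.
Fact field_over_scaleDr : right_distributive scale +%R.
Proof. by move=> a x y; apply: mulrDr. Qed.
Fact field_over_scaleDl (x : LF) : {morph scale^~ x : a b / a + b}.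
Proof. by move=> a b; rewrite /scale rmorphD mulrDl. Qed.
HB.instance Definition _ := GRing.Zmodule_isLmodule.Build F LF
  field_over_scaleA field_over_scale1 field_over_scaleDr field_over_scaleDl.

Lemma field_over_scaleE a (x : LF) : a *: x = iota a * (x : L).
Proof. by []. Qed.

Fact field_over_scaleAl a (x y : LF) : a *: (x * y) = (a *: x) * y.
Proof. exact: mulrA. Qed.
HB.instance Definition _ := GRing.Lmodule_isLalgebra.Build F LF field_over_scaleAl.

Fact field_over_scaleAr a (x y : LF) : a *: (x * y) = x * (a *: y).
Proof. exact: mulrCA. Qed.
HB.instance Definition _ := GRing.Lalgebra_isAlgebra.Build F LF field_over_scaleAr.

Variables (d : nat) (e : 'I_d -> L).
Hypothesis basis_e :
  forall y, exists! a : {ffun 'I_d -> F}, y = \sum_(i < d) iota (a i) * e i.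

(** Uniqueness of coordinates makes the chosen coordinate map linear and bijective. *)
Lemma field_over_vector : exists v2r : LF -> 'rV[F]_d, linear v2r /\ bijective v2r.
Proof.
have [a aP] := fun_choice basis_e.
have aE y : y = \sum_(i < d) iota (a y i) * e i by case: (aP y).
have aU y (b : {ffun 'I_d -> F}) : y = \sum_(i < d) iota (b i) * e i -> b = a y.
  by move=> yb; case: (aP y) => _ ay; rewrite (ay b yb).
exists (fun y => \row_i a y i); split.
  move=> c x y; apply/rowP => i; rewrite !mxE.
  have /= := congr1 (fun f : {ffun _ -> _} => f i)
    (aU (c *: x + y) [ffun l => c * a x l + a y l] _).
  rewrite ffunE => <- //; rewrite field_over_scaleE {1}(aE x) {1}(aE y) mulr_sumr -big_split.
  by apply: eq_bigr => l _; rewrite /= ffunE rmorphD rmorphM mulrDl mulrA.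
exists (fun v : 'rV[F]_d => \sum_(i < d) iota (v 0 i) * e i : LF) => [y|v].
  by rewrite [RHS](aE y); apply: eq_bigr => i _; rewrite mxE.
apply/rowP => i; rewrite !mxE.
rewrite -(aU _ [ffun l => v 0 l]) ?ffunE //.
by apply: eq_bigr => l _; rewrite ffunE.
Qed.

Lemma field_over_ext : exists (E : fieldExtType F) (phi : {rmorphism L -> E}),
  \dim {:E} = d /\ phi \o iota =1 in_alg E.
Proof.
have [v2r [lin bij]] := field_over_vector.
pose E : fieldExtType F := HB.pack LF (Lmodule_hasFinDim.Build F LF (exist2 _ _ v2r lin bij)).
pose phi : {rmorphism L -> E} := (@idfun L : {rmorphism L -> L}).
exists E, phi; split; first by rewrite dimvf.
by move=> a; rewrite /= -[RHS]/(iota a * 1) mulr1.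
Qed.
End FieldOver.

(** * Retract rationality and liftability of the generic point *)

(** [P] is a subring of [S * S'], so it suffices to test constants and variables, which generate the
    polynomial ring. *)
Lemma mpoly_related (R S S' : comNzRingType) (n : nat) (f : {rmorphism {mpoly R[n]} -> S})
    (g : {rmorphism {mpoly R[n]} -> S'}) (P : S -> S' -> Prop) :
  P 1 1 -> (forall x y x' y', P x x' -> P y y' -> P (x - y) (x' - y')) ->
  (forall x y x' y', P x x' -> P y y' -> P (x * y) (x' * y')) ->
  (forall c, P (f c%:MP) (g c%:MP)) -> (forall i, P (f 'X_i) (g 'X_i)) ->
  forall p, P (f p) (g p).
Proof.
move=> P1 PB PM PC PX p.
have P0 : P 0 0 by rewrite -(subrr 1) -[X in P _ X](subrr 1); apply: PB.
have PD x x' y y' : P x x' -> P y y' -> P (x + y) (x' + y').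
  move=> Px Py; rewrite -[y]opprK -[y']opprK -[- y]sub0r -[- y']sub0r.
  by do 2![apply: (PB) => //].
rewrite (mpolyE p) !rmorph_sum; apply: (big_ind2 P) => // m _.
rewrite -mul_mpolyC !rmorphM; apply: (PM) => //.
rewrite mpolyXE_id !rmorph_prod;
apply: (big_ind2 P) => [//|x x' y y' Px Py|i _]; first exact: (PM).
rewrite !rmorphXn; elim: (m i) => [|e IH]; rewrite ?expr0 ?exprS //.
exact: PM.
Qed.

Lemma common_denominator (D : idomainType) (n : nat) (u : 'I_n -> {fraction D}) :
  exists2 q : D, q != 0 & exists a : 'I_n -> D, forall i, u i = (a i)%:F / q%:F.
Proof.
have [ab abP] : exists ab : 'I_n -> D * D,
  forall i, (ab i).2 != 0 /\ u i = (ab i).1%:F / (ab i).2%:F.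
  apply: (fun_choice (P := fun i ab => ab.2 != 0 /\ u i = ab.1%:F / ab.2%:F)) => i.
  by have [a [b ?]] := fracP (u i); exists (a, b).
exists (\prod_i (ab i).2); first by apply/prodf_neq0 => i _; case: (abP i).
exists (fun i => (ab i).1 * \prod_(j | j != i) (ab j).2) => i.
have [b0 ->] := abP i; have bi0 : \prod_(j | j != i) (ab j).2 != 0.
  by apply/prodf_neq0 => j _; case: (abP j).
apply/eqP; rewrite eqr_div ?tofrac_eq0 //; last by rewrite (bigD1 i) //= mulf_neq0.
by rewrite (bigD1 i) //= !tofracM mulrAC mulrA mulrAC.
Qed.

Section RetractOfLiftable.
Variables (k : fieldType) (X : affVariety k).
Local Notation rF := (@tofrac (coord X) \o cst X)%FUN.

Definition generic_point : point X rF :=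
  @Point k X _ rF (@tofrac (coord X)) (fun c => erefl).

(** [u] is a rational map to affine space and [V] one back; that [V] takes the generic point as
    value at [u] says that the composite is the identity. *)
Lemma retract_of_liftable : liftable predT generic_point -> retract_rational X.
Proof.
move=> [n [u [g [V [_ [g0 Vx]]]]]].
pose ru : {rmorphism coord (affspace k n) -> funfield X} := mmap rF u.
have ruk c : ru (cst (affspace k n) c) = (cst X c)%:F by apply: mmapC.
have rureg : exists2 d, d != 0 & forall b, regular_fun d (ru b).
  have [q q0 [a ua]] := common_denominator u; exists q => // b.
  have qF : @tofrac (coord X) q != 0 by rewrite tofrac_eq0.
  have [|||||c [m [-> _]]] := @mpoly_related _ _ _ n ru ru (spec (@tofrac _) q) _ _ _ _ _ b.
  - exact: spec1.
  - by move=> *; apply: specB.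
  - by move=> *; apply: specM.
  - by move=> c; rewrite ruk; apply: spec_tofrac.
  - move=> i; rewrite /ru /= mmapX mmap1U ua.
    by exists (a i), 1%N; rewrite expr1.
  by exists c, m.
have Vreg : exists2 d : coord (affspace k n), d != 0 & forall b, regular_fun d (pt V b).
  exists g; first by rewrite -tofrac_eq0; apply: ev_neq0 g0.
  by move=> b; have [a [m [-> _]]] := Vx b; exists a, m.
exists n, (RatMap ruk rureg), (@RatMap k (affspace k n) X (pt V) (pt_cst V) Vreg).
by exists g => // c; have [a [m [Vc xc]]] := Vx c; exists a, m.
Qed.
End RetractOfLiftable.

(** Over the function field of [X'], of degree [d], the generic point is the value of [v] at the
    coordinates of [s]; the norm argument brings its [d]-th power down. *)
Lemma liftable_of_p_retract (p : nat) (k : fieldType) (T : groupVariety k) :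
  algebraic_torus T -> p_retract_rational p (gvar T) ->
  exists2 d, ~~ (p %| d)%N & liftable predT (gpow (generic_point (gvar T)) d).
Proof.
move=> hT [n [X' [f [_ domf [d [e eP] pd] [s [v [g g0 vg]]]]]]]; exists d => //.
have injf : injective (@tofrac (coord X') \o comorph f)%FUN.
  move=> a b /tofrac_inj ab; apply/eqP; rewrite -subr_eq0; apply/negP => /negP /domf.
  by rewrite rmorphB ab subrr eqxx.
have [E [phi [dimE phiE]]] := field_over_ext (iota := frac_map injf) eP.
rewrite -dimE; apply: liftable_ext => //.
pose u i := phi (comorph s 'X_i)%:F.
pose V := @Point k (gvar T) _ (@tofrac _ \o @mpolyC n k)%FUN (rcomorph v) (rcomorph_cst v).
exists n, u, g, V; split=> //.
have uE : mmap (in_alg E \o (@tofrac (coord (gvar T)) \o cst (gvar T)))%FUN u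
    =1 (phi \o (@tofrac (coord X') \o comorph s))%FUN.
  apply: mpoly_rmorph_ext => [c|i]; last by rewrite /= mmapX mmap1U.
  rewrite [LHS]mmapC -[LHS]/(in_alg E (cst _ c)%:F) -phiE; congr (phi _).
  rewrite frac_map_tofrac /= comorph_cst.
  by congr (_ %:F); exact: (esym (comorph_cst s c)).
split; first by rewrite [X in X != _](uE g) fmorph_eq0.
move=> c; have [b [m [vc fc]]] := vg c; exists b, m; split=> //.
rewrite [X in _ = X / _](uE b) [X in _ = _ / X ^+ _](uE g) -[LHS]/(in_alg E c%:F) -phiE /=.
rewrite -[frac_lift _ _]/(frac_map injf c%:F) frac_map_tofrac.
by rewrite [X in phi X]fc rmorphM fmorphV rmorphXn.
Qed.

(** Euclidean descent: if [d > 1] is in [I] and [e] in [I] is prime to a prime divisor of [d], then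
    [e %% d] is a smaller nonzero element of [I]. *)
Lemma nat_ideal_one (I : nat -> Prop) :
  (forall a b, I a -> I b -> I (a + b)%N) -> (forall a b, I (a + b)%N -> I b -> I a) ->
  (forall p, prime p -> exists2 d, ~~ (p %| d)%N & I d) -> I 1%N.
Proof.
move=> ID IB Ip.
have IM d m : I d -> I (m * d)%N.
  move=> Id; elim: m => [|m IH]; last by rewrite mulSn; apply: ID.
  by apply: (IB 0%N d); rewrite ?add0n.
(* The prime 2 only provides a nonzero element to start from. *)
have [d pd Id] := Ip 2 isT; have d0 : (0 < d)%N by case: d pd {Id}; rewrite ?dvdn0.
have [n] := ubnP d; elim: n d {pd} d0 Id => // n IH d d0 Id; rewrite ltnS => dn.
have [d1|d1] := eqVneq d 1%N; first by move: Id; rewrite d1.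
have pr : prime (pdiv d) by rewrite pdiv_prime // ltn_neqAle eq_sym d1.
have [e pe Ie] := Ip _ pr; apply: (IH (e %% d)%N).
- rewrite lt0n; apply: contra pe => de; exact: dvdn_trans (pdiv_dvd d) de.
- by apply: (IB _ (e %/ d * d)%N); rewrite ?[(e %% d + _)%N]addnC -?divn_eq //; apply: IM.
- exact: leq_trans (ltn_pmod _ d0) dn.
Qed.

Lemma has_degree_id (k : fieldType) (X : affVariety k) : has_degree (id_morphism X) 1.
Proof.
have fmE z : funfield_map (id_morphism X) z = z.
  by rewrite /funfield_map /= -frac_numden mulfK // tofrac_eq0 denom_ratioP.
exists (fun _ => 1) => y; exists [ffun => y]; split=> [|a].
  by rewrite big_ord1 fmE ffunE mulr1.
by rewrite big_ord1 fmE mulr1 => ->; apply/ffunP => i; rewrite ffunE (ord1 i).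
Qed.

Lemma finite_id (k : fieldType) (X : affVariety k) : finite_morphism (id_morphism X).
Proof. by exists 1%N, (fun _ => 1) => y; exists (fun _ => y); rewrite big_ord1 mulr1. Qed.

(* Writing the coordinates of [u] as [a_i / q], the map [s = (q, a_1, .., a_n)] is
   a morphism, and [v(y_1 / y_0, .., y_n / y_0)] is a left inverse of it. *)
Section Homogenize.
Variables (k : fieldType) (X : affVariety k) (n : nat).
Variables (u : ratmap X (affspace k n)) (v : ratmap (affspace k n) X).
Hypothesis uv : comp_is u v (ratmap_of (id_morphism X)).

Lemma p_retract_of_retract (p : nat) : prime p -> p_retract_rational p X.
Proof.
move=> pp; have [D D0 vD] := uv.
have [q q0 [a ua]] := common_denominator (fun i => rcomorph u 'X_i).
pose x0 : {mpoly k[n.+1]} := 'X_ord0.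
pose sc : {rmorphism coord (affspace k n.+1) -> coord X} :=
  mmap (cst X) (fun i => if unlift ord0 i is Some l then a l else q).
have scC c : sc (cst (affspace k n.+1) c) = cst X c by apply: mmapC.
pose s := Morphism scC.
pose ev : {rmorphism {mpoly k[n.+1]} -> funfield X} := (@tofrac _ \o sc)%FUN.
have evx0 : ev x0 = q%:F by rewrite /ev /sc /x0 /= mmapX mmap1U unlift_none.
have x00 : ev x0 != 0 by rewrite evx0 tofrac_eq0.
(* [tau] is dehomogenization with respect to the variable [x0]. *)
pose tau : {rmorphism {mpoly k[n]} -> funfield (affspace k n.+1)} :=
  mmap (@tofrac _ \o @mpolyC n.+1 k)%FUN (fun i => ('X_(lift ord0 i))%:F / x0%:F).
have tau_spec : forall P, spec ev x0 (tau P) (rcomorph u P).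
  apply: mpoly_related => [|x y x' y'|x y x' y'|c|i].
  - exact: spec1.
  - exact: specB.
  - exact: specM.
  - have -> : tau c%:MP = (c%:MP)%:F by apply: mmapC.
    have -> : rcomorph u c%:MP = ev c%:MP.
      by rewrite (rcomorph_cst u c) -[RHS]/(sc (cst (affspace k n.+1) c))%:F scC.
    exact: spec_tofrac.
  - exists 'X_(lift ord0 i), 1%N; rewrite !expr1; split.
      by rewrite /tau /= mmapX mmap1U.
    by rewrite ua evx0 /ev /sc /= mmapX mmap1U liftK.
have tauD : tau D != 0.
  apply: contra_neq D0 => tD; apply: (spec_uniq x00 (tau_spec D)).
  by rewrite tD -tofrac0 -(rmorph0 ev); apply: spec_tofrac.
have [|V VP] := spec_hom (V := rcomorph v) tauD.
  by move=> c; have [b [m [-> _]]] := vD c; eexists; exists b, m.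
have VC c : V (cst X c) = (cst (affspace k n.+1) c)%:F.
  apply: (spec_uniq tauD (VP _)); rewrite (rcomorph_cst v c).
  have -> : (cst (affspace k n.+1) c)%:F = tau c%:MP by apply/esym/mmapC.
  exact: spec_tofrac.
(* With [tau D = b / x0 ^+ e], its inverse is regular where [x0 * b] does not vanish. *)
have [b [e [tDb uDb]]] := tau_spec D.
have b0 : ev b != 0 by apply: contra_neq D0 => eb; rewrite uDb eb mul0r.
have g0 : ev (x0 * b) != 0 by rewrite [ev _](rmorphM ev x0 b) mulf_neq0.
have inv_spec : spec ev (x0 * b) (tau D)^-1 (rcomorph u D)^-1.
  have x0F := ev_neq0 x00; have bF := ev_neq0 b0.
  have expand (R : fieldType) (y c : R) : y != 0 -> y ^+ e / c = y ^+ e.+1 / (y * c).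
    by move=> y0; rewrite exprS -mulf_div mulfV ?mul1r.
  (* [x0 ^+ e / b] is expanded by [x0] to put [x0 * b] in the denominator. *)
  exists (x0 ^+ e.+1), 1%N; rewrite !expr1 tDb uDb !invf_div; split.
    rewrite (expand _ _ _ x0F); congr (_ / _); first exact: (esym (tofracXn _ _)).
    exact: (esym (tofracM _ _)).
  rewrite (expand _ _ _ x00); congr (_ / _); first exact: (esym (rmorphXn ev _ _)).
  exact: (esym (rmorphM ev _ _)).
have V_spec c : spec ev (x0 * b) (V c) c%:F.
  have [P [m [vc uc]]] := vD c.
  have -> : V c = tau P * (tau D)^-1 ^+ m.
    by rewrite exprVn; apply: (spec_uniq tauD (VP c)); exists P, m.
  have -> : c%:F = rcomorph u P * (rcomorph u D)^-1 ^+ m by rewrite exprVn; apply: uc.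
  apply: (specM g0); first exact: (specW b0 x00 (tau_spec P)).
  elim: m {vc uc} => [|m IH]; rewrite ?expr0 ?exprS; first exact: spec1.
  exact: (specM g0 inv_spec IH).
have Vreg : exists2 d : coord (affspace k n.+1), d != 0 & forall c, regular_fun d (V c).
  exists (x0 * b); first by rewrite -tofrac_eq0; apply: ev_neq0 g0.
  by move=> c; have [P [m [-> _]]] := V_spec c; exists P, m.
exists n.+1, X, (id_morphism X); split=> //.
- exact: finite_id.
- by exists 1%N; [apply: has_degree_id | rewrite dvdn1; case: eqP pp => // ->].
- by exists s, (RatMap VC Vreg); exists (x0 * b); [exact: g0 | exact: V_spec].
Qed.
End Homogenize.

Theorem theorem1p1 (k : fieldType) (T : groupVariety k)
    (hT : algebraic_torus T) :
  retract_rational (gvar T) <->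
  (forall p : nat, prime p -> p_retract_rational p (gvar T)).
Proof.
split=> [[n [u [v uv]]] p|Tp]; first exact: (p_retract_of_retract uv).
apply: retract_of_liftable.
(* These exponents are closed under sums and differences, as liftable points are under products and
   inverses. *)
pose I d := liftable predT (gpow (generic_point (gvar T)) d).
suff : I 1%N by rewrite /I gpowS gmulg1.
apply: nat_ideal_one => [a b Ia Ib|a b Iab Ib|p /Tp /(liftable_of_p_retract hT) //].
  by rewrite /I gpowD; apply: liftable_gmul.
rewrite /I -[gpow _ a]gmulg1 -(gmulgV (gpow (generic_point (gvar T)) b)) gmulA -gpowD.
by apply: liftable_gmul => //; apply: liftable_ginv.
Qed.
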